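(* Let $(X,\to,{}^*,1)$ be a quantum-Wajsberg algebra. Then $(X,\to,{}^*,1)$ is a Wajsberg algebra if and only if, for all $x,y\in X$, $x\le y$ implies $x\le_Q y$.
   Context: A BE algebra is an algebra $(X,\to,1)$ of type $(2,0)$ such that for all $x,y,z\in X$: $x\to x=1$; $x\to 1=1$; $1\to x=x$; $x\to(y\to z)=y\to(x\to z)$. Write $x\le y$ iff $x\to y=1$ (in general $\le$ is not a partial order). It is bounded if there is $0\in X$ with $0\le x$ for all $x$; then $x^*:=x\to 0$. A bounded BE algebra is involutive if $x^{**}=x$ for all $x$; it is then written $(X,\to,{}^*,1)$, with $0=1^*$. In an involutive BE algebra put $x\vee y:=(x\to y)\to y$, $x\wedge y:=(x^*\vee y^* )^*=((x^*\to y^* )\to y^* )^*$, and $x\le_Q y$ iff $x=x\wedge y$. A quantum-Wajsberg algebra is an involutive BE algebra satisfying $x\to ((x\wedge y)\wedge (z\wedge x))=(x\to y)\wedge (x\to z)$ for all $x,y,z\in X$. A Wajsberg algebra is an algebra $(X,\to,{}^*,1)$ of type $(2,1,0)$ such that for all $x,y,z\in X$: $1\to x=x$; $(y\to z)\to((z\to x)\to(y\to x))=1$; $(x\to y)\to y=(y\to x)\to x$; $(x^*\to y^* )\to(y\to x)=1$. *)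

(* Defs.v *)
Set Implicit Arguments.

Section Operations.

Variables (X : Type) (imp : X -> X -> X) (star : X -> X) (one : X).

Local Infix "-->" := imp (at level 55, right associativity).

(* Not an order in general: neither antisymmetry nor transitivity is assumed. *)
Definition be_le (x y : X) : Prop := x --> y = one.

(* Not commutative in general: the order of the arguments matters. *)
Definition join (x y : X) : X := (x --> y) --> y.

Definition meet (x y : X) : X := star (join (star x) (star y)).

Definition q_le (x y : X) : Prop := x = meet x y.

Record is_BE_algebra : Prop := {
  BE_imp_refl : forall x, x --> x = one;
  BE_imp_one : forall x, x --> one = one;
  BE_one_imp : forall x, one --> x = x;
  BE_exchange : forall x y z, x --> (y --> z) = y --> (x --> z)
}.

Record is_bounded_BE_algebra (zero : X) : Prop := {
  bounded_BE : is_BE_algebra;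
  bounded_BE_zero_le : forall x, be_le zero x
}.

(* The bottom element is not part of the signature; since [one --> x = x], it
   is necessarily [star one]. *)
Record is_involutive_BE_algebra : Prop := {
  involutive_BE_bounded : exists zero : X,
    is_bounded_BE_algebra zero /\ (forall x, star x = x --> zero);
  involutive_BE_starK : forall x, star (star x) = x
}.

Record is_quantum_Wajsberg_algebra : Prop := {
  QW_involutive_BE : is_involutive_BE_algebra;
  QW_axiom : forall x y z,
    x --> meet (meet x y) (meet z x) = meet (x --> y) (x --> z)
}.

Record is_Wajsberg_algebra : Prop := {
  W_one_imp : forall x, one --> x = x;
  W_imp_trans : forall x y z, (y --> z) --> ((z --> x) --> (y --> x)) = one;
  W_join_comm : forall x y, (x --> y) --> y = (y --> x) --> x;
  W_contrapos : forall x y, (star x --> star y) --> (y --> x) = one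
}.

End Operations.

(* Main.v *)
Require Import Defs.

Set Implicit Arguments.

(** If [<=] is contained in [<=_Q], then the common lower bound [meet x y] of
    [x] and [y] satisfies [meet x y = meet (meet x y) x], which only depends on
    [x] and on [x -> meet x y].  The quantum-Wajsberg axiom, instantiated at
    [z = 1], gives [x -> meet x y = x -> y], and hence [meet x y = meet y x].
    So the algebra is commutative, and a commutative BE algebra satisfies the
    transitivity axiom. *)

Section InvolutiveBE.

Variables (X : Type) (imp : X -> X -> X) (star : X -> X) (one : X).
Hypothesis HX : is_involutive_BE_algebra imp star one.

Local Infix "-->" := imp (at level 55, right associativity).
Local Notation meet := (meet imp star).
Local Notation join := (join imp).

Lemma involutive_BE_BE : is_BE_algebra imp one.
Proof. destruct HX as [[zero [[H _] _]] _]; exact H. Qed.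

Let starK := involutive_BE_starK HX.
Let imp_refl := BE_imp_refl involutive_BE_BE.
Let imp_one := BE_imp_one involutive_BE_BE.
Let one_imp := BE_one_imp involutive_BE_BE.
Let exchange := BE_exchange involutive_BE_BE.

(** Since [star y] is [y --> zero], exchange moves [y] to the front and leaves [star (star x)]
    behind it. *)
Lemma star_imp_star x y : star x --> star y = y --> x.
Proof.
  destruct (involutive_BE_bounded HX) as [zero [_ Hstar]].
  now rewrite (Hstar y), exchange, <- Hstar, starK.
Qed.

Lemma imp_star_one x : x --> star one = star x.
Proof. now rewrite <- star_imp_star, starK, one_imp. Qed.

(** In this form the first argument occurs only inside [y --> x], so it can be replaced by any
    element with the same implication from [y]. *)
Lemma meetE x y : meet x y = star ((y --> x) --> star y).
Proof. unfold Defs.meet, Defs.join; now rewrite star_imp_star. Qed.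

Lemma meet_one_r x : meet x one = x.
Proof. now rewrite meetE, one_imp, imp_star_one, starK. Qed.

Lemma meet_one_l x : meet one x = x.
Proof. now rewrite meetE, imp_one, one_imp, starK. Qed.

Lemma meet_le_l x y : be_le imp one (meet x y) x.
Proof.
  unfold be_le, Defs.meet, Defs.join.
  now rewrite <- star_imp_star, starK, exchange, imp_refl.
Qed.

Lemma meet_of_ge x y : be_le imp one y x -> meet x y = y.
Proof.
  unfold be_le; intros Hyx.
  now rewrite meetE, Hyx, one_imp, starK.
Qed.

(** De Morgan duality through the involution. *)
Lemma join_comm_of_meet_comm :
  (forall x y, meet x y = meet y x) -> forall x y, join x y = join y x.
Proof.
  intros Hmeet x y.
  rewrite <- (starK (join x y)), <- (starK (join y x)); f_equal.
  generalize (Hmeet (star x) (star y)).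
  unfold Defs.meet; now rewrite !starK.
Qed.

Lemma imp_trans_of_join_comm :
  (forall x y, join x y = join y x) ->
  forall x y z, (y --> z) --> ((z --> x) --> (y --> x)) = one.
Proof.
  unfold Defs.join; intros Hjoin x y z.
  (* Exchange exposes [(z --> x) --> x]; once it is swapped to [(x --> z) --> z], pulling [x --> z]
     outwards leaves [(y --> z) --> (y --> z)]. *)
  rewrite (exchange (z --> x) y x), (Hjoin z x), (exchange y).
  now rewrite exchange, imp_refl, imp_one.
Qed.

Lemma join_comm_Wajsberg :
  (forall x y, join x y = join y x) -> is_Wajsberg_algebra imp star one.
Proof.
  intros Hjoin; constructor.
  - exact one_imp.
  - exact (imp_trans_of_join_comm Hjoin).
  - exact Hjoin.
  - intros x y; now rewrite star_imp_star, imp_refl.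
Qed.

Lemma Wajsberg_q_le x y :
  is_Wajsberg_algebra imp star one -> be_le imp one x y -> q_le imp star x y.
Proof.
  unfold q_le; intros HW Hxy.
  (* Swapping the join of [star x] and [star y] turns [meet x y] into [meet y x]. *)
  unfold Defs.meet, Defs.join; rewrite (W_join_comm HW).
  symmetry; exact (meet_of_ge Hxy).
Qed.

End InvolutiveBE.

Lemma QW_meet_comm (X : Type) (imp : X -> X -> X) (star : X -> X) (one : X)
    (HX : is_quantum_Wajsberg_algebra imp star one)
    (Hle : forall x y : X, be_le imp one x y -> q_le imp star x y) (x y : X) :
  meet imp star x y = meet imp star y x.
Proof.
  pose proof (QW_involutive_BE HX) as HI.
  pose proof (Hle _ _ (meet_le_l HI x y)) as Hxy; unfold q_le in Hxy.
  assert (Himp : imp x (meet imp star x y) = imp x y).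
  (* As [meet one x] is [x], [Hxy] collapses the left side to [x --> meet x y]; as [x --> one] is
     [one], the right side is [x --> y]. *)
  { generalize (QW_axiom HX x y one).
    rewrite (meet_one_l HI), <- Hxy, (BE_imp_one (involutive_BE_BE HI)).
    now rewrite (meet_one_r HI). }
  now rewrite Hxy, (meetE HI), Himp, <- (meetE HI).
Qed.

Theorem theorem4p10 (X : Type) (imp : X -> X -> X) (star : X -> X) (one : X)
    (HX : is_quantum_Wajsberg_algebra imp star one) :
  is_Wajsberg_algebra imp star one <->
  (forall x y : X, be_le imp one x y -> q_le imp star x y).
Proof.
  pose proof (QW_involutive_BE HX) as HI.
  split.
  - intros HW x y; exact (Wajsberg_q_le HI HW).
  - intros Hle; apply (join_comm_Wajsberg HI), (join_comm_of_meet_comm HI).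
    exact (QW_meet_comm HX Hle).
Qed.
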